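(* Let $f:[0,+\infty)\to(-\infty,0]$ be a smooth function with $f(0)=0$, $f'(t)<0$ for all $t\ge 0$, and $\lim_{t\to+\infty}f(t)=-\infty$. Let $\mathcal{B}_0(T^2)\cong\mathbb{H}^2\times\mathbb{C}^*$ be the deformation space of properly convex $\mathbb{RP}^2$-structures on the torus, with coordinates $z=x+iy$ on $\mathbb{H}^2$ (so $y>0$) and $w=u+iv$ on $\mathbb{C}^*$, endowed with the symplectic form $\boldsymbol{\omega}_f$ (defined in the context). Let $$H_1(z,w)=\tfrac23 f\big(y^3|w|^2\big),\qquad H_2(z,w)=2\tfrac{x}{y}\big(1-f(y^3|w|^2)\big),$$ $H=(H_1,H_2):\mathcal{B}_0(T^2)\to\mathbb{R}^2$ and $B=H(\mathcal{B}_0(T^2))$. Let $(s,\theta)\in\mathbb{R}\times S^1\cong H^{-1}(b)$, $b\in B$, be the Arnold--Liouville angle coordinates on the fibres of $H$. Then $\{\theta,H_1,s,H_2\}$ is a global Darboux frame for $\boldsymbol{\omega}_f$. Explicitly: there is a smooth map $(s,\theta):\mathcal{B}_0(T^2)\to\mathbb{R}\times S^1$, $S^1=\mathbb{R}/2\pi\mathbb{Z}$, restricting to a diffeomorphism $H^{-1}(b)\to\mathbb{R}\times S^1$ for every $b\in B$, such that $(\theta,H_1,s,H_2)$ are global coordinates on $\mathcal{B}_0(T^2)$, $\frac{\partial}{\partial\theta}=\mathbb{X}_{H_1}$, $\frac{\partial}{\partial s}=\mathbb{X}_{H_2}$, and $$\boldsymbol{\omega}_f=\mathrm{d}\theta\wedge\mathrm{d}H_1+\mathrm{d}s\wedge\mathrm{d}H_2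 .$$
   Context: $\mathbb{H}^2=\{x+iy : y>0\}$ is the upper half-plane. The deformation space $\mathcal{B}_0(T^2)$ of properly convex $\mathbb{RP}^2$-structures on the torus (marked structures up to projective isomorphism compatible with the markings up to isotopy) is identified with the space of pairs $(J,q)$, where $J$ is a point of the Teichmuller space of $T^2$ (identified with $\mathbb{H}^2$) and $q\neq0$ is a $J$-holomorphic cubic differential on $T^2$. This is the complement of the zero section in a trivial complex line bundle over $\mathbb{H}^2$, so $\mathcal{B}_0(T^2)\cong\mathbb{H}^2\times\mathbb{C}^*$, and all objects below are given on $\mathbb{H}^2\times\mathbb{C}^*$. The symplectic form is $$\boldsymbol{\omega}_f=\big(-1+f-3f'y^3(u^2+v^2)\big)\frac{\mathrm{d}x\wedge\mathrm{d}y}{y^2}-\frac43 f'y^3\,\mathrm{d}u\wedge\mathrm{d}v-2y^2f'\Big(u(\mathrm{d}x\wedge\mathrm{d}u+\mathrm{d}y\wedge\mathrm{d}v)+v(\mathrm{d}u\wedge\mathrm{d}y-\mathrm{d}v\wedge\mathrm{d}x)\Big),$$ where $f,f'$ are evaluated at $y^3(u^2+v^2)$. For a function $g$, the Hamiltonian vector field $\mathbb{X}_g$ is defined by $\boldsymbol{\omega}_f(\mathbb{X}_g,\cdot)=\mathrm{d}g$. Here $\mathbb{X}_{H_1}=u\frac{\partial}{\partial v}-v\frac{\partial}{\partial u}$ and $\mathbb{X}_{H_2}=2\big(x\frac{\partial}{\partial x}+y\frac{\partial}{\partial y}\big)-3\big(u\frac{\partial}{\partial u}+v\frac{\partial}{\partial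 v}\big)$. Arnold--Liouville angle coordinates are coordinates along the fibres of $H$ in which the flows of $\mathbb{X}_{H_1},\mathbb{X}_{H_2}$ are linear, normalized here so that $\theta$ and $s$ are the flow parameters of $\mathbb{X}_{H_1}$ and $\mathbb{X}_{H_2}$. *)

(* Defs.v *)
From HB Require Import structures.
From mathcomp Require Import all_boot all_order all_algebra.
From mathcomp Require Import all_classical all_reals all_analysis.

Set Implicit Arguments.
Unset Strict Implicit.
Unset Printing Implicit Defensive.

Import Order.TTheory GRing.Theory Num.Theory.
Import numFieldNormedType.Exports.

Local Open Scope classical_set_scope.
Local Open Scope ring_scope.
Local Open Scope quotient_scope.

Section Circle.
Variable R : realType.

Definition period : {pred R} := fun x => x / (2 * pi) \is a Num.int.

Fact period_zmod_closed : zmod_closed period.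
Proof.
have E x : (x \in period) = (x / (2 * pi) \is a Num.int) by [].
split=> [|x y]; rewrite !E; first by rewrite mul0r rpred0.
by move=> hx hy; rewrite mulrBl rpredB.
Qed.

HB.instance Definition _ :=
  GRing.isZmodClosed.Build R period period_zmod_closed.

(* S^1 = R / 2 pi Z, as a quotient group. *)
Definition circle : Type := Quotient.quot period.

Definition toS1 (x : R) : circle := \pi_(Quotient.quot period) x.

(* The representative in [-pi, pi[. *)
Definition ang (c : circle) : R :=
  let x : R := repr (c : Quotient.quot period) in
  x - 2 * pi * (Num.floor ((x + pi) / (2 * pi)))%:~R.

End Circle.

Section Smooth.
Variable R : realType.

(* Quotient by which the derivative of [f : [0, +oo) -> R] is defined; at 0 only
   nonnegative increments are allowed, so values of [f] at negative reals are
   never used. *)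
Definition half_derive (f : R -> R) (t : R) : R :=
  lim (h^-1 * (f (h + t) - f t) @[h --> within [set h | 0 <= h + t] 0^']).

Definition half_derivable (f : R -> R) (t : R) : Prop :=
  cvg (h^-1 * (f (h + t) - f t) @[h --> within [set h | 0 <= h + t] 0^']).

Definition half_smooth (f : R -> R) : Prop :=
  forall (n : nat) (t : R), 0 <= t -> half_derivable (iter n half_derive f) t.

(* C^oo on an open set: all iterated directional derivatives exist and are
   (Frechet) differentiable there. *)
Definition smooth_on (m n : nat) (U : set 'rV[R]_m) (g : 'rV[R]_m -> 'rV[R]_n)
    : Prop :=
  forall (vs : seq 'rV[R]_m) (p : 'rV[R]_m), U p ->
    differentiable (foldr (fun v h => 'D_v h) g vs) p.

(* Below, the manifold [M] is R x S^1 or S^1 x R^3, with the topology and the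
   smooth structure for which its universal covering [cov : R^n -> M] is a
   local diffeomorphism. *)

(* [A] is an arbitrary subset of R^m (possibly a submanifold): smoothness on [A]
   means that around each point the map is the restriction of a smooth map
   defined on an open set. *)
Definition smooth_map (m n : nat) (M : Type) (cov : 'rV[R]_n -> M)
    (A : set 'rV[R]_m) (g : 'rV[R]_m -> M) : Prop :=
  forall p, A p ->
    exists (N : set 'rV[R]_m) (lift : 'rV[R]_m -> 'rV[R]_n),
      [/\ open N, N p, smooth_on N lift &
          forall q, A q -> N q -> g q = cov (lift q)].

Definition inv_on (m : nat) (M : Type) (A : set 'rV[R]_m) (g : 'rV[R]_m -> M)
    : M -> 'rV[R]_m := 'pinv_(fun=> 0) A g.

Definition diffeo (m n : nat) (M : Type) (cov : 'rV[R]_n -> M)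
    (A : set 'rV[R]_m) (O : set M) (g : 'rV[R]_m -> M) : Prop :=
  [/\ open (cov @^-1` O),
      smooth_map cov A g,
      set_bij A O g &
      smooth_on (cov @^-1` O) (inv_on A g \o cov)].

End Smooth.

Section DeformationSpace.
Variable R : realType.
Implicit Types (f : R -> R) (p V W : 'rV[R]_4).

(* Points, and tangent vectors, are written (x, y, u, v). *)
Definition cx p : R := p 0 0.
Definition cy p : R := p 0 1.
Definition cu p : R := p 0 2.
Definition cv p : R := p 0 3.

(* H^2 x C^* with z = x + iy, w = u + iv. *)
Definition B0 : set 'rV[R]_4 :=
  [set p | 0 < cy p /\ (cu p, cv p) != (0, 0)].

Definition invt p : R := cy p ^+ 3 * (cu p ^+ 2 + cv p ^+ 2).

Definition wedge (a b : 'rV[R]_4 -> R) V W : R := a V * b W - a W * b V.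

(* The coordinate functions being linear, they are their own differentials. *)
Definition dx := cx.
Definition dy := cy.
Definition du := cu.
Definition dv := cv.

Definition omega f p V W : R :=
  let y := cy p in let u := cu p in let v := cv p in
  let F := f (invt p) in let F' := half_derive f (invt p) in
  (- 1 + F - 3 * F' * y ^+ 3 * (u ^+ 2 + v ^+ 2)) * (wedge dx dy V W / y ^+ 2)
  - 4 / 3 * F' * y ^+ 3 * wedge du dv V W
  - 2 * y ^+ 2 * F' * (u * (wedge dx du V W + wedge dy dv V W)
                       + v * (wedge du dy V W - wedge dv dx V W)).

Definition H1 f p : R := 2 / 3 * f (invt p).
Definition H2 f p : R := 2 * (cx p / cy p) * (1 - f (invt p)).
Definition H f p : R * R := (H1 f p, H2 f p).
Definition B f : set (R * R) := H f @` B0.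
Definition fibre f (b : R * R) : set 'rV[R]_4 := B0 `&` H f @^-1` [set b].

(* The vector X with omega(X, .) = dg at p; it is unique since omega, for the f of
   interest (f <= 0, f' < 0), is nondegenerate on B0. *)
Definition hamiltonian_vf f (g : 'rV[R]_4 -> R) p : 'rV[R]_4 :=
  get [set X | forall V, omega f p X V = 'd g p V].

Definition cov_RS1 (c : 'rV[R]_2) : R * circle R := (c 0 0, toS1 (c 0 1)).
Definition cov_S1R3 (c : 'rV[R]_4) : circle R * R * R * R :=
  (toS1 (c 0 0), c 0 1, c 0 2, c 0 3).

(* The differential at p of a circle-valued function, read in the chart of S^1
   centred at theta p. *)
Definition dS1 (theta : 'rV[R]_4 -> circle R) p : 'rV[R]_4 -> R :=
  'd (fun q => ang (theta q - theta p)) p.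

Definition frame f (stheta : 'rV[R]_4 -> R * circle R) p
    : circle R * R * R * R :=
  ((stheta p).2, H1 f p, (stheta p).1, H2 f p).

(* The i-th coordinate vector field of a coordinate system
   [Phi : B0 -> S^1 x R^3], at the point with coordinates cov_S1R3 c. *)
Definition coord_vf (Phi : 'rV[R]_4 -> circle R * R * R * R) (i : 'I_4)
    (c : 'rV[R]_4) : 'rV[R]_4 :=
  'D_(delta_mx 0 i) (inv_on B0 Phi \o cov_S1R3) c.

End DeformationSpace.

(* Main.v *)
Require Import Defs.
From mathcomp Require Import all_boot all_order all_algebra.
From mathcomp Require Import all_classical all_reals all_analysis.
From mathcomp Require Import ring lra.
Set Implicit Arguments.
Unset Strict Implicit.
Unset Printing Implicit Defensive.
Import Order.TTheory GRing.Theory Num.Theory.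
Import numFieldNormedType.Exports.
Local Open Scope classical_set_scope.
Local Open Scope ring_scope.

(** Write w = r e^{i phi} and t = y^3 r^2, and let f, f' stand for their values
at t. In polar coordinates, with wedge signs omitted, the form is
  omega = (-1 + f - 3 f' t) dx dy / y^2 - 4/3 f' y^3 r dr dphi
          - 2 y^2 f' (r dx dr + r^2 dy dphi).
The terms that contain dphi are exactly dphi dH1, because H1 = 2/3 f(t) and
dt = 3 y^2 r^2 dy + 2 y^3 r dr. With s = (ln y)/2, what is left after ds dH2 is
removed is - f' d(x/y) dt = - 3/2 d(x/y) dH1. Hence
  theta = arg w - 3/2 (x/y),    s = (ln y)/2
satisfy omega = dtheta dH1 + ds dH2; this is omega_darboux, an identity of
rational functions once the four differentials are known.

The rest is the inversion of the coordinates. A point is determined by the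
slope x/y, the invariant t, s and arg w: y = e^{2s} and
r = exp ((ln t)/2 - 3 s) (point_of, point_coords). The pair (H1, H2) determines
t and x/y, since f is strictly decreasing on the positive half-line and
1 - f > 0, so a fibre of H is the cylinder of all (s, theta) over one value of
(t, x/y) (diffeo_fibre), and the whole frame is inverted by the formula
inv_frame (diffeo_frame). Moving theta alone turns w, moving s alone scales
(x, y, u, v) by (e^{2h}, e^{2h}, e^{-3h}, e^{-3h}); so the coordinate fields are
the rotation and the dilation field. Pairing them with the Darboux form gives
dH1 and dH2, and since omega is nondegenerate (omega_nondegenerate) they are the
Hamiltonian fields.

Smoothness means that all iterated directional derivatives are differentiable.
It is handled through the finite-order classes smooth_upto, which are closed
under products, compositions and solutions of first-order differential
equations; the last point covers exp, ln, 1/x, atan and the inverse function of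
f. The half-line derivative of f is the ordinary one at positive t, and t > 0
on the whole deformation space. *)

(** * Calculus of smooth functions *)

Section SmoothCalculus.
Variable R : realType.
Implicit Types (V W : normedModType R).

(** The first-order expansion of h at p is also one of g, so both have the
same differential. *)
Lemma near_eq_differentiable V W (g h : V -> W) p :
  {near p, g =1 h} -> differentiable h p -> differentiable g p.
Proof.
move=> gh dh.
have gph : g p = h p by exact: nbhs_singleton gh.
have gE : g \o shift p = cst (g p) + 'd h p +o_ 0 id.
  apply/eqaddoP => e e0.
  have /eqaddoP/(_ e e0) := diff_locally dh.
  have : \forall q \near (0:V), g (q + p) = h (q + p).
    by move: gh; rewrite (near_shift 0) subr0.
  by apply: filterS2 => q gq; rewrite !fctE /= gq gph.
have dE := diff_unique (diff_continuous dh) gE.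
by apply/diff_locallyP; rewrite dE; split=> //; exact: diff_continuous.
Qed.

(** Smoothness of finite order, by recursion on the order rather than over
lists of directions: closure under products and compositions then follows by
induction from the product and chain rules. *)
Fixpoint smooth_upto V W (n : nat) (U : set V) (g : V -> W) : Prop :=
  (forall p, U p -> differentiable g p) /\
  if n is n'.+1 then forall v, smooth_upto n' U ('D_v g) else True.

Lemma smooth_upto_differentiable V W n U (g : V -> W) p :
  smooth_upto n U g -> U p -> differentiable g p.
Proof. by case: n => [|n] [+ _] => /[apply]. Qed.

Lemma open_eq_near V W (U : set V) (g h : V -> W) p :
  open U -> {in U, g =1 h} -> U p -> {near p, g =1 h}.
Proof.
move=> oU gh Up; apply: filterS (open_nbhs_nbhs (conj oU Up)) => q Uq.
by apply: gh; rewrite inE.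
Qed.

Lemma eq_smooth_upto V W n (U : set V) (g h : V -> W) :
  open U -> {in U, g =1 h} -> smooth_upto n U h -> smooth_upto n U g.
Proof.
move=> oU; elim: n g h => [|n IH] g h gh [dh sh].
  split=> // p Up.
  exact: near_eq_differentiable (open_eq_near oU gh Up) (dh p Up).
split=> [p Up|v].
  exact: near_eq_differentiable (open_eq_near oU gh Up) (dh p Up).
apply: IH (sh v) => p; rewrite inE => Up.
exact/near_eq_derive/(open_eq_near oU gh Up).
Qed.

Lemma smooth_uptoW V W n (U : set V) (g : V -> W) :
  smooth_upto n.+1 U g -> smooth_upto n U g.
Proof. by elim: n g => [|n IH] g [dg sg] //; split => // v; exact: IH. Qed.

Lemma smooth_upto_sub V W n (U U' : set V) (g : V -> W) :
  U `<=` U' -> smooth_upto n U' g -> smooth_upto n U g.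
Proof.
move=> UU'; elim: n g => [|n IH] g [dg sg];
  (have D p : U p -> differentiable g p by auto); split=> // v.
exact: IH (sg v).
Qed.

Lemma smooth_upto_cst V W n (U : set V) (a : W) : smooth_upto n U (cst a).
Proof.
elim: n a => [|n IH] a; split=> // v.
rewrite (_ : 'D_v _ = cst 0) //.
by apply/funext => p; exact: derive_val.
Qed.

Lemma smooth_uptoD V W n (U : set V) (g h : V -> W) : open U ->
  smooth_upto n U g -> smooth_upto n U h -> smooth_upto n U (g + h).
Proof.
move=> oU; elim: n g h => [|n IH] g h [dg sg] [dh sh];
  (have D p : U p -> differentiable (g + h) p
    by move=> Up; apply: differentiableD; auto);
  split=> // v.
apply: (@eq_smooth_upto _ _ _ _ _ ('D_v g + 'D_v h)) => //;
  last exact: IH (sg v) (sh v).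
move=> p; rewrite inE => Up.
by rewrite deriveD //; apply: diff_derivable; auto.
Qed.

Lemma smooth_uptoM V n (U : set V) (g h : V -> R) : open U ->
  smooth_upto n U g -> smooth_upto n U h -> smooth_upto n U (g * h).
Proof.
move=> oU; elim: n g h => [|n IH] g h Sg Sh; have [dg sg] := Sg;
  have [dh sh] := Sh;
  (have D p : U p -> differentiable (g * h) p
    by move=> Up; apply: differentiableM; auto);
  split=> // v.
apply: (@eq_smooth_upto _ _ _ _ _ (g * 'D_v h + h * 'D_v g)) => //.
  move=> p; rewrite inE => Up.
  by rewrite deriveM //; apply: diff_derivable; auto.
apply: smooth_uptoD => //; apply: IH;
  by first [exact: smooth_uptoW|exact: sg|exact: sh].
Qed.

Lemma smooth_uptoZl V W n (U : set V) (g : V -> R) (w : W) : open U ->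
  smooth_upto n U g -> smooth_upto n U (fun p => g p *: w).
Proof.
move=> oU; elim: n g => [|n IH] g [dg sg];
  (have D p : U p -> differentiable (fun p => g p *: w) p
    by move=> Up; apply: differentiableZl; auto);
  split=> // v.
apply: (@eq_smooth_upto _ _ _ _ _ (fun p => 'D_v g p *: w)) => //;
  last exact: IH (sg v).
move=> p; rewrite inE => Up.
have d : differentiable g p by auto.
by rewrite deriveE ?diffZl //=; [rewrite deriveE|exact: differentiableZl].
Qed.

Lemma derive_comp1 V (g : V -> R) (phi : R -> R) p v :
  differentiable g p -> differentiable phi (g p) ->
  'D_v (phi \o g) p = 'D_1 phi (g p) * 'D_v g p.
Proof.
move=> dg dphi; rewrite !deriveE//; last exact: differentiable_comp.
by rewrite diff_comp //= -[X in 'd phi _ X]mulr1 [LHS]linearZ mulrC.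
Qed.

Lemma smooth_upto_comp V n (U : set V) (I : set R) (g : V -> R) (phi : R -> R) :
  open U -> (forall p, U p -> I (g p)) ->
  smooth_upto n I phi -> smooth_upto n U g -> smooth_upto n U (phi \o g).
Proof.
move=> oU UI; elim: n g UI phi => [|n IH] g UI phi Sphi Sg;
  have [dphi sphi] := Sphi; have [dg sg] := Sg;
  (have D p : U p -> differentiable (phi \o g) p
    by move=> Up; apply: differentiable_comp; auto);
  split=> // v.
apply: (@eq_smooth_upto _ _ _ _ _ (('D_1 phi \o g) * 'D_v g)) => //.
  by move=> p; rewrite inE => Up; rewrite derive_comp1; auto.
apply: smooth_uptoM (sg v) => //.
apply: IH UI _ (sphi 1) _; exact: smooth_uptoW.
Qed.

Definition smooth V W (U : set V) (g : V -> W) := forall n, smooth_upto n U g.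

Lemma smooth_smooth_on m n (U : set 'rV[R]_m) (g : 'rV[R]_m -> 'rV[R]_n) :
  smooth U g -> smooth_on U g.
Proof.
move=> sg vs p Up; move: {sg}(sg (size vs)).
elim/last_ind: vs g => [|vs v IH] g; first by case=> + _; exact.
by rewrite size_rcons foldr_rcons => -[_ /(_ v)]; exact: IH.
Qed.

Lemma smooth_of_derive V W (U : set V) (g : V -> W) :
  (forall p, U p -> differentiable g p) -> (forall v, smooth U ('D_v g)) ->
  smooth U g.
Proof. by move=> dg sg [|n]; split=> // v; exact: sg. Qed.

Lemma derive_smul (phi : R -> R) x v : derivable phi x 1 ->
  'D_v phi x = v * 'D_1 phi x.
Proof.
move=> /derivable1_diffP d; rewrite !deriveE //.
by rewrite -[v in LHS]mulr1 [LHS]linearZ.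
Qed.

Lemma smooth_upto_of_derive n (I : set R) (phi phi' : R -> R) : open I ->
  (forall x, I x -> is_derive x 1 phi (phi' x)) ->
  smooth_upto n I phi' -> smooth_upto n.+1 I phi.
Proof.
move=> oI d s; split=> [x /d|v]; first by case=> /derivable1_diffP.
apply: (@eq_smooth_upto _ _ _ _ _ (cst v * phi')) => //; last first.
  by apply: smooth_uptoM => //; exact: smooth_upto_cst.
by move=> x; rewrite inE => /d [dx dE]; rewrite derive_smul // dE.
Qed.

Lemma smooth_upto0_of_derive (I : set R) (phi phi' : R -> R) :
  (forall x, I x -> is_derive x 1 phi (phi' x)) -> smooth_upto 0 I phi.
Proof. by move=> d; split=> // x /d[/derivable1_diffP]. Qed.

(** The derivative may depend on phi itself, as in exp' = exp: its smoothness
at order k is only asked for once phi is smooth at order k, and this feeds the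
next order. *)
Lemma smooth_upto_ode n (I : set R) (phi phi' : R -> R) : open I ->
  (forall x, I x -> is_derive x 1 phi (phi' x)) ->
  (forall k, (k < n)%N -> smooth_upto k I phi -> smooth_upto k I phi') ->
  smooth_upto n I phi.
Proof.
move=> oI d; elim: n => [|n IH] s; first exact: smooth_upto0_of_derive d.
apply: (smooth_upto_of_derive oI d); apply: (s) => //.
by apply: IH => k kn; apply: s; exact: ltnW.
Qed.

Lemma smooth_expR : smooth setT (@expR R).
Proof.
by move=> n; apply: (smooth_upto_ode openT) => // x _; exact: is_derive_expR.
Qed.

Lemma smooth_uptoN V n (U : set V) (g : V -> R) : open U ->
  smooth_upto n U g -> smooth_upto n U (fun p => - g p).
Proof.
move=> oU sg; apply: (@eq_smooth_upto _ _ _ _ _ (cst (-1) * g)) => //.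
  by move=> p _; rewrite [RHS]mulN1r.
by apply: smooth_uptoM => //; exact: smooth_upto_cst.
Qed.

(** Each is the derivative of the other up to sign, so the induction is joint.
*)
Lemma smooth_sin_cos : smooth setT (@sin R) /\ smooth setT (@cos R).
Proof.
suff H n : smooth_upto n setT (@sin R) /\ smooth_upto n setT (@cos R).
  by split=> n; case: (H n).
elim: n => [|n [IHs IHc]]; split.
- by apply: smooth_upto0_of_derive => x _; exact: is_derive_sin.
- by apply: smooth_upto0_of_derive => x _; exact: is_derive_cos.
- exact: smooth_upto_of_derive openT _ IHc.
- exact: smooth_upto_of_derive openT _ (smooth_uptoN openT IHs).
Qed.

Lemma open_neq0 : open [set x : R | x != 0].
Proof. exact: open_neq. Qed.

Lemma smooth_inv : smooth [set x : R | x != 0] (@GRing.inv R).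
Proof.
move=> n; apply: (@smooth_upto_ode _ _ _ (fun x => - (x^-1 * x^-1)) open_neq0).
  move=> x /= x0; apply: is_derive_eq (is_deriveV x0 _) _.
  by rewrite /GRing.scale /= mulr1 expr2 invfM.
move=> k _ sk; apply: (smooth_uptoN open_neq0).
exact: smooth_uptoM open_neq0 _ _.
Qed.

Lemma open_pos : open [set x : R | 0 < x].
Proof. exact: open_gt. Qed.

Lemma smooth_ln : smooth [set x : R | 0 < x] (@ln R).
Proof.
move=> n; apply: (@smooth_upto_ode _ _ _ (@GRing.inv R) open_pos).
move=> k _ _; apply: smooth_upto_sub (smooth_inv k) => x /= x0.
by rewrite gt_eqF.
Qed.

Lemma smooth_id : smooth setT (@id R).
Proof.
move=> n; apply: (@smooth_upto_ode _ _ _ (cst 1) openT) => k _ _.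
exact: smooth_upto_cst.
Qed.

Lemma smoothD V W (U : set V) (g h : V -> W) : open U ->
  smooth U g -> smooth U h -> smooth U (fun p => g p + h p).
Proof. by move=> oU sg sh n; exact: (smooth_uptoD oU (sg n) (sh n)). Qed.

Lemma smoothM V (U : set V) (g h : V -> R) : open U ->
  smooth U g -> smooth U h -> smooth U (fun p => g p * h p).
Proof. by move=> oU sg sh n; exact: (smooth_uptoM oU (sg n) (sh n)). Qed.

Lemma smoothN V (U : set V) (g : V -> R) : open U ->
  smooth U g -> smooth U (fun p => - g p).
Proof. by move=> oU sg n; exact: (smooth_uptoN oU (sg n)). Qed.

Lemma smooth_cst V W (U : set V) (a : W) : smooth U (fun _ => a).
Proof. by move=> n; exact: smooth_upto_cst. Qed.

Lemma smooth_comp V (U : set V) (I : set R) (phi : R -> R) (g : V -> R) :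
  open U -> (forall p, U p -> I (g p)) ->
  smooth I phi -> smooth U g -> smooth U (fun p => phi (g p)).
Proof.
by move=> oU UI sphi sg n; exact: smooth_upto_comp UI (sphi n) (sg n).
Qed.

Lemma smoothV V (U : set V) (g : V -> R) : open U ->
  (forall p, U p -> g p != 0) ->
  smooth U g -> smooth U (fun p => (g p)^-1).
Proof. by move=> oU g0 sg; exact: smooth_comp g0 smooth_inv sg. Qed.

Lemma eq_smooth V W (U : set V) (g h : V -> W) :
  open U -> {in U, g =1 h} -> smooth U h -> smooth U g.
Proof. by move=> oU gh sh n; exact: eq_smooth_upto gh (sh n). Qed.

Lemma smooth_atan : smooth setT (@atan R).
Proof.
move=> n; apply: (@smooth_upto_ode _ _ _ (fun x => (1 + x * x)^-1) openT).
move=> k _ _; apply: smoothV openT _ _ k => [x _|].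
  by rewrite gt_eqF // -expr2 ltr_pwDl ?sqr_ge0.
have s1 : smooth setT (fun _ : R => 1 : R) by exact: smooth_cst.
exact: smoothD openT s1 (smoothM openT smooth_id smooth_id).
Qed.

(** The inverse function solves psi' = 1 / (phi' o psi), whose right-hand side
is as smooth as psi. *)
Lemma smooth_inverse (I J : set R) (phi psi : R -> R) :
  open I -> open J ->
  (forall x, I x -> J (phi x)) -> (forall y, J y -> I (psi y)) ->
  (forall x, I x -> psi (phi x) = x) -> (forall y, J y -> phi (psi y) = y) ->
  smooth I phi -> (forall x, I x -> 'D_1 phi x != 0) ->
  smooth J psi.
Proof.
move=> oI oJ IJ JI phiK psiK sphi d0 n.
have dphi x : I x -> derivable phi x 1.
  by move=> Ix; apply/derivable1_diffP; case: (sphi 0) => + _; exact.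
apply: (@smooth_upto_ode _ _ _ (fun y => ('D_1 phi (psi y))^-1) oJ).
  move=> y Jy; have Ix := JI _ Jy; rewrite -{1}(psiK _ Jy).
  apply: is_derive_inverse (d0 _ Ix).
  - by apply: filterS (open_nbhs_nbhs (conj oI Ix)).
  - apply: filterS (open_nbhs_nbhs (conj oI Ix)) => x /dphi /derivable1_diffP.
    exact: differentiable_continuous.
  - exact/derivableP/dphi.
move=> k _ sk; apply: (@smooth_upto_comp _ _ _ [set x | x != 0]
  ('D_1 phi \o psi) (@GRing.inv R)) => //.
- by move=> y Jy /=; exact/d0/JI.
- exact: smooth_inv.
apply: smooth_upto_comp JI _ sk => //.
by case: (sphi k.+1) => _; exact.
Qed.

Lemma derive_coord n (p v : 'rV[R]_n) i :
  'D_v (fun q : 'rV[R]_n => q 0 i : R) p = v 0 i.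
Proof.
have /matrixP/(_ 0 i) := derive_mx (@derivable_id _ _ p v).
by rewrite derive_id mxE.
Qed.

Lemma smooth_coord n (U : set 'rV[R]_n) i : smooth U (fun p => p 0 i : R).
Proof.
apply: smooth_of_derive => [p _|v]; first exact: differentiable_coord.
suff -> : 'D_v (fun p : 'rV[R]_n => p 0 i : R) = cst (v 0 i).
  exact: smooth_cst.
by apply/funext => p; exact: derive_coord.
Qed.

End SmoothCalculus.

(** * Row-vector-valued functions *)

Section Rows.
Variable R : realType.

Definition row_of n (s : seq R) : 'rV[R]_n := \row_(i < n) nth 0 s i.

Lemma smooth_sum (V W : normedModType R) (U : set V) (I : Type) (r : seq I)
    (F : I -> V -> W) : open U ->
  (forall i, smooth U (F i)) -> smooth U (fun p => \sum_(i <- r) F i p).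
Proof.
move=> oU sF; elim: r => [|i r IH].
  by apply: eq_smooth oU _ (smooth_cst U (0 : W)) => p _; rewrite big_nil.
by apply: eq_smooth oU _ (smoothD oU (sF i) IH) => p _; rewrite big_cons.
Qed.

Lemma smooth_row n (V : normedModType R) (U : set V) (F : 'I_n -> V -> R) :
  open U -> (forall i, smooth U (F i)) ->
  smooth U (fun p => \row_(i < n) F i p).
Proof.
move=> oU sF.
apply: (@eq_smooth _ _ _ _ _
  (fun p => \sum_(i < n) F i p *: (delta_mx 0 i : 'rV[R]_n)) oU).
  by move=> p _; rewrite [LHS]row_sum_delta; apply: eq_bigr => i _; rewrite mxE.
by apply: smooth_sum => // i m; exact: (smooth_uptoZl _ oU (sF i m)).
Qed.

Lemma row_of_entry n (s : seq R) (i : 'I_n) : row_of n s 0 i = nth 0 s i.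
Proof. by rewrite mxE. Qed.

Lemma smooth_row_of n (V : normedModType R) (U : set V) (F : V -> seq R) :
  open U -> (forall i, (i < n)%N -> smooth U (fun x => nth 0 (F x) i)) ->
  smooth U (fun x => row_of n (F x)).
Proof. by move=> oU sF; apply: smooth_row => // i; exact: sF. Qed.

Lemma eq_derive (V W : normedModType R) (g h : V -> W) x v :
  g =1 h -> 'D_v g x = 'D_v h x.
Proof. by move=> /funext ->. Qed.

(** A directional derivative only sees the restriction to a line; this reduces
the coordinate vector fields to derivatives of curves. *)
Lemma derive_line (V W : normedModType R) (g : V -> W) (p v : V) :
  'D_v g p = 'D_1 (fun h : R => g (h *: v + p)) 0.
Proof.
rewrite /derive; set g1 := fun h => h^-1 *: _; set g2 := fun h => h^-1 *: _.
suff -> : g1 = g2 by []; apply/funext => h; rewrite /g1 /g2 /=.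
by rewrite addr0 scale0r add0r [_%:A]mulr1.
Qed.

Lemma diff_near_eq (V : normedModType R) (g h : V -> R) p v :
  {near p, g =1 h} -> differentiable h p -> 'd g p v = 'D_v h p.
Proof.
move=> gh dh; rewrite -deriveE; last exact: near_eq_differentiable gh dh.
exact: near_eq_derive.
Qed.

End Rows.

(** * Rules for directional derivatives *)

Section Diff.
Variable R : realType.
Implicit Types (V : normedModType R).

(** Differentiability and the value of one directional derivative are kept
together: the chain rule needs the former, the Darboux form the latter. *)
Definition has_diff V (g : V -> R) (p v : V) (d : R) :=
  differentiable g p /\ 'D_v g p = d.

Lemma has_diff_cst V p v (a : R) : has_diff (fun _ : V => a) p v 0.
Proof. split; [exact: differentiable_cst|exact: derive_cst]. Qed.

Lemma has_diffD V (g h : V -> R) p v a b :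
  has_diff g p v a -> has_diff h p v b ->
  has_diff (fun q => g q + h q) p v (a + b).
Proof.
move=> [dg <-] [dh <-]; split; first exact: differentiableD.
by apply: deriveD; exact: diff_derivable.
Qed.

Lemma has_diffM V (g h : V -> R) p v a b :
  has_diff g p v a -> has_diff h p v b ->
  has_diff (fun q => g q * h q) p v (g p * b + h p * a).
Proof.
move=> [dg <-] [dh <-]; split; first exact: differentiableM.
by apply: deriveM; exact: diff_derivable.
Qed.

Lemma has_diff_comp V (g : V -> R) (phi : R -> R) p v a b :
  is_derive (g p) 1 phi b -> has_diff g p v a ->
  has_diff (fun q => phi (g q)) p v (b * a).
Proof.
move=> [/derivable1_diffP dphi <-] [dg <-].
by split; [exact: differentiable_comp|exact: derive_comp1].
Qed.

Lemma has_diffN V (g : V -> R) p v a : has_diff g p v a ->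
  has_diff (fun q => - g q) p v (- a).
Proof.
move=> [dg <-]; split; first exact: differentiableN.
by apply: deriveN; exact: diff_derivable.
Qed.

Lemma has_diffX V (g : V -> R) n p v a : has_diff g p v a ->
  has_diff (fun q => g q ^+ n) p v (n%:R * g p ^+ n.-1 * a).
Proof.
move=> h; apply: (has_diff_comp (phi := fun x : R => x ^+ n)) h.
split; first exact: exprn_derivable.
by rewrite exp_derive /GRing.scale /= mulr1.
Qed.

Lemma has_diffV V (g : V -> R) p v a : g p != 0 -> has_diff g p v a ->
  has_diff (fun q => (g q)^-1) p v (- (g p) ^- 2 * a).
Proof.
move=> g0; apply: has_diff_comp; apply: is_derive_eq (is_deriveV g0 _) _.
by rewrite /GRing.scale /= mulr1.
Qed.

Lemma has_diff_coord n (p v : 'rV[R]_n) i :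
  has_diff (fun q : 'rV[R]_n => q 0 i : R) p v (v 0 i).
Proof. by split; [exact: differentiable_coord|exact: derive_coord]. Qed.

Lemma has_diff_eq V (g : V -> R) p v a b :
  has_diff g p v a -> a = b -> has_diff g p v b.
Proof. by move=> ? <-. Qed.

Lemma diff_has_diff V (g : V -> R) p v a : has_diff g p v a -> 'd g p v = a.
Proof. by move=> [dg <-]; rewrite deriveE. Qed.

Lemma derive_row n V (M : V -> 'rV[R]_n) p v (D : 'rV[R]_n) :
  (forall i, is_derive p v (fun q => M q 0 i) (D 0 i)) -> 'D_v M p = D.
Proof.
move=> dM; rewrite derive_mx; last first.
  by apply/derivable_mxP => i j; rewrite ord1; case: (dM j).
by apply/rowP => j; rewrite mxE; case: (dM j).
Qed.

Lemma derive_row_of n V (F : V -> seq R) (x v : V) (D : seq R) :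
  (forall i, (i < n)%N -> has_diff (fun y => nth 0 (F y) i) x v (nth 0 D i)) ->
  'D_v (fun y => row_of n (F y)) x = row_of n D.
Proof.
move=> dF; apply: derive_row => i; have [dFi eFi] := dF i (ltn_ord i).
have e : (fun y => row_of n (F y) 0 i) = (fun y => nth 0 (F y) i).
  by apply/funext => y; rewrite row_of_entry.
rewrite e row_of_entry -eFi; apply: derivableP; exact: diff_derivable.
Qed.

Lemma has_diff_id (x v : R) : has_diff (fun h : R => h) x v v.
Proof. by split; [exact/derivable1_diffP/derivable_id|exact: derive_id]. Qed.

Lemma smooth_open_gt0 V (g : V -> R) : smooth setT g -> open [set q | 0 < g q].
Proof.
move=> sg; apply: (@open_comp _ _ g [set x : R | 0 < x]); last exact: open_gt.
move=> q _; apply: differentiable_continuous.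
exact: smooth_upto_differentiable (sg 0%N) _.
Qed.

End Diff.

Ltac has_diff_rules :=
  repeat first [exact: has_diff_cst | exact: has_diff_coord | apply: has_diffX
   | apply: has_diffM | apply: has_diffD | apply: has_diffN | apply: has_diffV].

Ltac smooth_rules :=
  repeat first [exact: smooth_cst | exact: smooth_coord | apply: smoothM
   | apply: smoothD | apply: smoothN | apply: smoothV].

(** * Diffeomorphisms read in a covering *)

Section Diffeomorphisms.
Variable R : realType.

Lemma smooth_mapW m n (M : Type) (cov : 'rV[R]_n -> M) (A B : set 'rV[R]_m) g :
  A `<=` B -> smooth_map cov B g -> smooth_map cov A g.
Proof.
move=> AB sg p /AB/sg [N [l [oN Np sl lE]]].
by exists N, l; split=> // q /AB; exact: lE.
Qed.

(** An inverse G written on the covering space yields injectivity because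
every point of the target has a lift c, and G c recovers the source point. On
the open preimage of O the abstract inverse then agrees with G, so it inherits
the smoothness of G. *)
Lemma diffeo_of_inverse m n (M : Type) (cov : 'rV[R]_n -> M)
    (A : set 'rV[R]_m) (O : set M) (g : 'rV[R]_m -> M)
    (G : 'rV[R]_n -> 'rV[R]_m) :
  (forall z : M, exists c, cov c = z) ->
  open (cov @^-1` O) -> smooth_map cov A g -> g @` A `<=` O ->
  (forall c, O (cov c) -> A (G c) /\ g (G c) = cov c) ->
  (forall p c, A p -> cov c = g p -> G c = p) ->
  smooth (cov @^-1` O) G ->
  diffeo cov A O g /\ {in cov @^-1` O, inv_on A g \o cov =1 G}.
Proof.
move=> covS oO sg gA gG Gg sG.
have ginj : {in A &, injective g}.
  move=> p q; rewrite !inE => Ap Aq gpq; have [c cE] := covS (g p).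
  by rewrite -(Gg p c) // (Gg q c) // cE.
have invE : {in cov @^-1` O, inv_on A g \o cov =1 G}.
  move=> c; rewrite inE => /gG [AG e] /=.
  by rewrite -e /inv_on pinvKV // inE.
split=> //; split=> //; last exact/smooth_smooth_on/(eq_smooth oO invE).
split=> [p Ap|//|z Oz]; first by apply: gA; exists p.
have [c cz] := covS z; move: Oz; rewrite -cz => /gG[AG gGE].
by exists (G c).
Qed.

End Diffeomorphisms.

(** * Angles modulo 2 pi *)

Section Angles.
Variable R : realType.
Implicit Types x y : R.

Lemma toS1B x y : toS1 x - toS1 y = toS1 (x - y).
Proof. by rewrite /toS1 [RHS]raddfB. Qed.

Lemma toS1D x y : toS1 x + toS1 y = toS1 (x + y).
Proof. by rewrite /toS1 [RHS]raddfD. Qed.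

Lemma toS1_eqP x y : toS1 x = toS1 y <-> x - y \in @period R.
Proof.
rewrite /toS1; split=> [/eqP|xy]; last (apply/eqP);
  by rewrite -Quotient.idealrBE.
Qed.

Lemma periodP x : x \in @period R -> exists k : int, x = 2 * pi * k%:~R.
Proof.
move=> /intrP[k xk]; exists k; rewrite -xk mulrC divfK //.
by rewrite mulf_neq0 // gt_eqF // pi_gt0.
Qed.

Lemma mem_period (k : int) : 2 * pi * k%:~R \in @period R.
Proof.
rewrite unfold_in /period mulrAC divff ?mul1r ?rpred_int //.
by rewrite mulf_neq0 // gt_eqF // pi_gt0.
Qed.

Lemma ang_toS1 x : - pi <= x < pi -> ang (toS1 x) = x.
Proof.
move=> /andP[x1 x2]; rewrite /ang.
set r : R := repr _.
have /toS1_eqP/periodP[k] : toS1 r = toS1 x by rewrite /toS1 reprK.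
have p0 := pi_gt0 R.
move=> rx; have -> : r = x + 2 * pi * k%:~R by rewrite -rx; ring.
suff -> : Num.floor ((x + 2 * pi * k%:~R + pi) / (2 * pi)) = k by rewrite addrK.
apply/floor_def; rewrite intrD mulr1z; apply/andP; split.
  by rewrite ler_pdivlMr; nra.
by rewrite ltr_pdivrMr; nra.
Qed.

Lemma cos_sin_period x y : y \in @period R ->
  cos (x + y) = cos x /\ sin (x + y) = sin x.
Proof.
move=> /periodP[k ->].
have H n (z : R) :
    cos (z + 2 * pi * n%:R) = cos z /\ sin (z + 2 * pi * n%:R) = sin z.
  have -> : 2 * pi * n%:R = pi *+ 2 *+ n :> R.
    by rewrite -[pi *+ 2]mulr_natl mulr_natr.
  by rewrite (periodicn (@cosD2pi R)) (periodicn (@sinD2pi R)).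
case: k => n; first exact: H.
rewrite NegzE mulrNz; have [h1 h2] := H n.+1 (x + 2 * pi * - n.+1%:~R).
by rewrite -h1 -h2 mulrN subrK.
Qed.

(** With d = x - y, cos d = 1; the representative of d in [-pi, pi] then
vanishes because cos is injective on [0, pi]. *)
Lemma toS1_of_cos_sin x y : cos x = cos y -> sin x = sin y -> toS1 x = toS1 y.
Proof.
move=> cxy sxy; apply/toS1_eqP.
pose d := x - y; rewrite -/d.
have cd : cos d = 1 by rewrite /d cosB cxy sxy -!expr2 cos2Dsin2.
pose k := Num.floor ((d + pi) / (2 * pi)).
pose e := d - 2 * pi * k%:~R.
have p0 := pi_gt0 R.
have ce : cos e = 1.
  rewrite -cd -[d](subrK (2 * pi * k%:~R)).
  by have [-> _] := cos_sin_period (d - 2 * pi * k%:~R) (mem_period k).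
have /andP[e1 e2] : - pi <= e <= pi.
  have := floor_le ((d + pi) / (2 * pi)).
  have := floorD1_gt ((d + pi) / (2 * pi)).
  rewrite -/k ler_pdivlMr ?ltr_pdivrMr ?intrD ?mulr1z; try lra.
  by move=> h1 h2; rewrite /e; apply/andP; split; lra.
have e0 : e = 0.
  have [e0|e0] := leP 0 e.
    by rewrite -[e]cosK ?in_itv /= ?e0 ?e2 // ce acos1.
  apply/eqP; rewrite -oppr_eq0; apply/eqP.
  by rewrite -[- e]cosK ?in_itv /= ?cosN ?ce ?acos1 //; lra.
have -> : d = 2 * pi * k%:~R by apply/eqP; rewrite -subr_eq0; apply/eqP.
exact: mem_period.
Qed.

Lemma cos_sin_of_toS1 x y : toS1 x = toS1 y -> cos x = cos y /\ sin x = sin y.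
Proof.
by move=> /toS1_eqP /(cos_sin_period y) []; rewrite addrC subrK => -> ->.
Qed.

(** With r the modulus, the arccosine of a / r is such an angle up to the sign,
which is that of b. *)
Lemma polar_angle (a b : R) : (a, b) != (0, 0) ->
  exists phi : R, a = Num.sqrt (a ^+ 2 + b ^+ 2) * cos phi /\
     b = Num.sqrt (a ^+ 2 + b ^+ 2) * sin phi.
Proof.
move=> ab0; set n := a ^+ 2 + b ^+ 2.
have n0 : 0 < n.
  rewrite lt_neqAle addr_ge0 ?sqr_ge0 // andbT eq_sym paddr_eq0 ?sqr_ge0 //.
  by rewrite !sqrf_eq0; apply: contra ab0 => /andP[/eqP -> /eqP ->].
set r := Num.sqrt n; have r0 : 0 < r by rewrite sqrtr_gt0.
have rn : r ^+ 2 = n by rewrite sqr_sqrtr // ltW.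
have arn : r ^+ 2 = a ^+ 2 + b ^+ 2 by [].
have ar : -1 <= a / r <= 1.
  rewrite ler_pdivlMr // ler_pdivrMr // mulN1r mul1r -ler_norml.
  rewrite -[leRHS]gtr0_norm // -ler_sqr ?nnegrE // ?normr_ge0 //.
  by rewrite !real_normK ?num_real // rn lerDl sqr_ge0.
have sa : r * Num.sqrt (1 - (a / r) ^+ 2) = `|b|.
  rewrite -[X in X * _](gtr0_norm r0) -sqrtr_sqr -sqrtrM ?sqr_ge0 // -sqrtr_sqr.
  congr Num.sqrt; rewrite mulrBr mulr1 -exprMn [r * _]mulrC.
  by rewrite divfK ?gt_eqF // arn addrC addKr.
have ca : a = r * cos (acos (a / r)).
  by rewrite acosK // mulrC divfK // gt_eqF.
have [b0|b0] := leP 0 b.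
  exists (acos (a / r)); split=> //.
  by rewrite sin_acos // sa ger0_norm.
exists (- acos (a / r)); rewrite cosN sinN; split=> //.
by rewrite sin_acos // mulrN sa ltr0_norm ?opprK.
Qed.

(** The two angles have the same tangent, and both cosines are positive. *)
Lemma atan_polar (a b r phi : R) : 0 < a -> 0 < r ->
  a = r * cos phi -> b = r * sin phi -> toS1 (atan (b / a)) = toS1 phi.
Proof.
move=> a0 r0 ea eb; have c0 : 0 < cos phi by rewrite ea pmulr_rgt0 in a0.
have ba : b / a = tan phi.
  by rewrite ea eb /tan invfM mulrACA divff ?mul1r // gt_eqF.
have cc : cos (atan (b / a)) = cos phi.
  rewrite cos_atan ba -cos2_tan2 ?gt_eqF // sqrtrV ?sqr_ge0 // sqrtr_sqr invrK.
  exact: gtr0_norm.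
apply: toS1_of_cos_sin => //.
have := atanK (b / a); rewrite {2}ba /tan cc.
move=> /(congr1 (fun z => z * cos phi)).
by rewrite !divfK ?gt_eqF.
Qed.

End Angles.

(** * Smooth decreasing functions on the positive half-line *)

Section HalfLine.
Variable R : realType.
Implicit Types (g : R -> R) (t : R).

(** At a positive t, small increments are all admissible. *)
Lemma within_shift_pos t : 0 < t ->
  within [set h | 0 <= h + t] (0 : R)^' = (0 : R)^'.
Proof.
move=> t0; apply/seteqP; split=> A; last exact: cvg_within.
rewrite /within /= => AA.
have H : \forall h \near (0 : R)^', 0 <= h + t.
  apply: nbhs_dnbhs; have := @nbhs0_lt _ R _ t0; apply: filterS => h ht.
  rewrite addrC -[h]opprK subr_ge0 ltW // (le_lt_trans _ ht) //.
  by rewrite -normrN ler_norm.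
by apply: filterS2 H AA => h H1; exact.
Qed.

Lemma half_quotientE g t :
  (fun h => h^-1 *: ((g \o shift t) (h *: (1 : R)) - g t)) =
  (fun h => h^-1 * (g (h + t) - g t)).
Proof. by apply/funext => h /=; rewrite /GRing.scale /= mulr1. Qed.

Lemma half_deriveE g t : 0 < t -> half_derive g t = 'D_1 g t.
Proof.
by move=> t0; rewrite /half_derive /derive (within_shift_pos t0) half_quotientE.
Qed.

Lemma half_derivableE g t : 0 < t -> half_derivable g t -> derivable g t 1.
Proof.
move=> t0; rewrite /half_derivable /derivable (within_shift_pos t0).
by rewrite half_quotientE.
Qed.

(** The iterated half-line derivatives of g form a sequence of functions on
the positive half-line in which each is the ordinary derivative of the
previous one. *)
Lemma half_smooth_pos g : half_smooth g -> smooth [set t : R | 0 < t] g.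
Proof.
move=> sg n; pose gk k := iter k (@half_derive R) g.
suff H k : smooth_upto n [set t : R | 0 < t] (gk k) by exact: (H 0%N).
have dg j (x : R) : 0 < x -> is_derive x 1 (gk j) (gk j.+1 x).
  move=> x0; rewrite /gk iterS half_deriveE //; apply/derivableP.
  by apply: half_derivableE => //; exact/sg/ltW.
elim: n k => [|n IH] k; first exact: smooth_upto0_of_derive (dg k).
exact: smooth_upto_of_derive (@open_pos R) (dg k) (IH k.+1).
Qed.

Variable g : R -> R.
Hypothesis sg : smooth [set t : R | 0 < t] g.
Hypothesis g'_lt0 : forall t, 0 < t -> 'D_1 g t < 0.

Lemma derivable_pos t : 0 < t -> derivable g t 1.
Proof.
move=> t0; apply/derivable1_diffP.
exact: smooth_upto_differentiable (sg 0) _.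
Qed.

Lemma continuous_segment_pos a b : 0 < a -> {within `[a, b], continuous g}.
Proof.
move=> a0; apply: derivable_within_continuous => x.
rewrite in_itv /= => /andP[ax _]; exact/derivable_pos/(lt_le_trans a0).
Qed.

Lemma decr_pos x y : 0 < x -> x < y -> g y < g x.
Proof.
move=> x0 xy; apply: (@ltr0_derive1_decr _ _ x y) => //.
- by move=> z /[!in_itv] /andP[xz _]; exact/derivable_pos/(lt_trans x0).
- move=> z /[!in_itv] /andP[xz _]; rewrite derive1E.
  exact/g'_lt0/(lt_trans x0).
- exact: continuous_segment_pos.
Qed.

Lemma inj_pos x y : 0 < x -> 0 < y -> g x = g y -> x = y.
Proof.
move=> x0 y0 gxy; case: (ltgtP x y) => // [/(decr_pos x0)|/(decr_pos y0)];
  by rewrite gxy ltxx.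
Qed.

Definition image_pos := g @` [set t : R | 0 < t].

(** By the intermediate value theorem on [t/2, 2t] the image contains the open
interval ]g (2t), g (t/2)[ around g t. *)
Lemma open_image_pos : open image_pos.
Proof.
rewrite openE => _ [t /= t0 <-].
have h0 : 0 < t / 2 by rewrite divr_gt0.
have h1 : t / 2 < t by lra.
have h2 : t < 2 * t by lra.
have : nbhs (g t) `]g (2 * t), g (t / 2)[%classic.
  by apply: near_in_itvoo; rewrite in_itv /= !decr_pos.
apply: filterS => y /=; rewrite in_itv /= => /andP[y1 y2].
have le12 : t / 2 <= 2 * t by lra.
have cg := @continuous_segment_pos (t / 2) (2 * t) h0.
have [|c] := @IVT _ g (t / 2) (2 * t) y le12 cg.
  by rewrite ge_min le_max (ltW y1) (ltW y2) orbT.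
by rewrite in_itv /= => /andP[c1 _] <-; exists c => //=; exact: lt_le_trans c1.
Qed.

Definition inv_pos y : R := get [set t | 0 < t /\ g t = y].

Lemma inv_posP y : image_pos y -> 0 < inv_pos y /\ g (inv_pos y) = y.
Proof.
by move=> [t t0 gt]; apply: (@getPex _ [set t | 0 < t /\ g t = y]); exists t.
Qed.

Lemma inv_posK t : 0 < t -> inv_pos (g t) = t.
Proof.
move=> t0; have [|i0 gi] := @inv_posP (g t); first by exists t.
exact: inj_pos.
Qed.

Lemma smooth_inv_pos : smooth image_pos inv_pos.
Proof.
apply: (@smooth_inverse _ [set t : R | 0 < t] _ g) => //.
- exact: (@open_image_pos).
- by move=> t t0; exists t.
- by move=> y /inv_posP[].
- exact: inv_posK.
- by move=> y /inv_posP[].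
- by move=> t t0; rewrite lt_eqF // g'_lt0.
Qed.

End HalfLine.

(** * Polar coordinates on the deformation space *)

Section Coordinates.
Variable R : realType.
Implicit Types (p V W : 'rV[R]_4) (k t s phi : R).

Lemma B0_norm2_gt0 p : B0 p -> 0 < cu p ^+ 2 + cv p ^+ 2.
Proof.
move=> [_ uv0]; rewrite lt_neqAle addr_ge0 ?sqr_ge0 // andbT eq_sym.
rewrite paddr_eq0 ?sqr_ge0 // !sqrf_eq0.
by apply: contra uv0 => /andP[/eqP -> /eqP ->].
Qed.

Lemma invt_gt0 p : B0 p -> 0 < invt p.
Proof.
by move=> Bp; rewrite mulr_gt0 ?B0_norm2_gt0 // exprn_gt0 //; case: Bp.
Qed.

(** The modulus of w at a point with y = e^{2s} and y^3 |w|^2 = t, written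
with exp so that its derivatives are immediate. *)
Definition modulus t s : R := expR (ln t / 2 - 3 * s).

(** The point with slope k, invariant t, logarithmic scale s and argument phi
of w. *)
Definition point_of k t s phi : 'rV[R]_4 :=
  row_of 4 [:: k * expR (2 * s); expR (2 * s);
               modulus t s * cos phi; modulus t s * sin phi].

Definition argw p : R :=
  get [set phi | cu p = Num.sqrt (cu p ^+ 2 + cv p ^+ 2) * cos phi /\
                 cv p = Num.sqrt (cu p ^+ 2 + cv p ^+ 2) * sin phi].

Lemma argwP p : B0 p ->
  cu p = Num.sqrt (cu p ^+ 2 + cv p ^+ 2) * cos (argw p) /\
  cv p = Num.sqrt (cu p ^+ 2 + cv p ^+ 2) * sin (argw p).
Proof.
move=> [_ /polar_angle [phi h]].
exact: (@getPex _ [set phi | _ /\ _] (ex_intro _ phi h)).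
Qed.

Definition slope p := cx p / cy p.
Definition logscale p := ln (cy p) / 2.

Lemma cx_point k t s phi : cx (point_of k t s phi) = k * expR (2 * s).
Proof. by rewrite /cx mxE. Qed.
Lemma cy_point k t s phi : cy (point_of k t s phi) = expR (2 * s).
Proof. by rewrite /cy mxE. Qed.
Lemma cu_point k t s phi : cu (point_of k t s phi) = modulus t s * cos phi.
Proof. by rewrite /cu mxE. Qed.
Lemma cv_point k t s phi : cv (point_of k t s phi) = modulus t s * sin phi.
Proof. by rewrite /cv mxE. Qed.
Definition pointE := (cx_point, cy_point, cu_point, cv_point).

Lemma norm2_point k t s phi :
  cu (point_of k t s phi) ^+ 2 + cv (point_of k t s phi) ^+ 2 =
  modulus t s ^+ 2.
Proof. by rewrite !pointE !exprMn -mulrDr cos2Dsin2 mulr1. Qed.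

Lemma point_B0 k t s phi : B0 (point_of k t s phi).
Proof.
split; first by rewrite cy_point expR_gt0.
have : cu (point_of k t s phi) ^+ 2 + cv (point_of k t s phi) ^+ 2 != 0.
  by rewrite norm2_point sqrf_eq0 gt_eqF // expR_gt0.
by apply: contra => /eqP[-> ->]; rewrite !expr0n /= addr0.
Qed.

Lemma invt_point k t s phi : 0 < t -> invt (point_of k t s phi) = t.
Proof.
move=> t0; rewrite /invt norm2_point cy_point /modulus -!expRM_natl -expRD.
by rewrite -[RHS]lnK //; congr expR; lra.
Qed.

Lemma slope_point k t s phi : slope (point_of k t s phi) = k.
Proof. by rewrite /slope !pointE mulfK // gt_eqF // expR_gt0. Qed.

Lemma logscale_point k t s phi : logscale (point_of k t s phi) = s.
Proof. by rewrite /logscale !pointE expRK; lra. Qed.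

Lemma argw_point k t s phi : toS1 (argw (point_of k t s phi)) = toS1 phi.
Proof.
have := argwP (point_B0 k t s phi); rewrite norm2_point !pointE.
have r0 : 0 < modulus t s by rewrite expR_gt0.
rewrite sqrtr_sqr gtr0_norm // => -[/(mulfI _) c /(mulfI _) s'].
by apply: toS1_of_cos_sin; [rewrite c|rewrite s']; rewrite ?gt_eqF.
Qed.

Lemma point_of_toS1 k t s phi psi : toS1 phi = toS1 psi ->
  point_of k t s phi = point_of k t s psi.
Proof. by move=> /cos_sin_of_toS1 [c s']; rewrite /point_of c s'. Qed.

Lemma eq_of_coords p q :
  cx p = cx q -> cy p = cy q -> cu p = cu q -> cv p = cv q -> p = q.
Proof.
move=> e0 e1 e2 e3; apply/rowP => -[[|[|[|[|i]]]] Hi] //.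
- by rewrite (_ : Ordinal Hi = 0) //; exact: val_inj.
- by rewrite (_ : Ordinal Hi = 1) //; exact: val_inj.
- by rewrite (_ : Ordinal Hi = 2) //; exact: val_inj.
- by rewrite (_ : Ordinal Hi = 3) //; exact: val_inj.
Qed.

Lemma point_coords p : B0 p ->
  point_of (slope p) (invt p) (logscale p) (argw p) = p.
Proof.
move=> Bp; have [y0 _] := Bp; have n0 := B0_norm2_gt0 Bp.
have ey : expR (2 * logscale p) = cy p.
  by rewrite /logscale mulrC divfK ?pnatr_eq0 // lnK.
have er : modulus (invt p) (logscale p) = Num.sqrt (cu p ^+ 2 + cv p ^+ 2).
  rewrite /modulus /invt lnM ?posrE ?exprn_gt0 // lnXn //.
  rewrite -[RHS]lnK ?posrE ?sqrtr_gt0 // -{1}(sqr_sqrtr (ltW n0)).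
  rewrite lnXn ?sqrtr_gt0 // /logscale.
  by congr expR; move: (ln _) (ln _) => a b; lra.
have [eu ev] := argwP Bp.
apply: eq_of_coords; rewrite !pointE ?ey ?er -?eu -?ev //.
by rewrite /slope divfK // gt_eqF.
Qed.

End Coordinates.

(** * The angle coordinates *)

Section Angle.
Variable R : realType.
Implicit Types (p q V W : 'rV[R]_4) (k t s phi : R).

(** The correction by the slope absorbs the term of omega that remains after
darg dH1 + ds dH2. *)
Definition theta p : circle R := toS1 (argw p - 3 / 2 * slope p).

Definition rot_re phi q := cu q * cos phi + cv q * sin phi.
Definition rot_im phi q := cv q * cos phi - cu q * sin phi.

(** A half-plane in w centred on the direction phi, where the argument of w
is phi plus an arctangent; over it the circle-valued angle has a real lift. *)
Definition chart phi : set 'rV[R]_4 :=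
  [set q | 0 < cy q] `&` [set q | 0 < rot_re phi q].

Definition theta_lift phi q : R :=
  phi + atan (rot_im phi q / rot_re phi q) - 3 / 2 * slope q.

Lemma open_chart phi : open (chart phi).
Proof.
apply: openI; apply: smooth_open_gt0; rewrite /rot_re /cy /cu /cv;
  smooth_rules; exact: openT.
Qed.

Lemma chart_B0 phi : chart phi `<=` @B0 R.
Proof.
move=> q [/= y0 a0]; split=> //; apply: contraTneq a0 => -[u0 v0].
by rewrite /rot_re u0 v0 !mul0r addr0 ltxx.
Qed.

Lemma chart_argw p : B0 p -> chart (argw p) p.
Proof.
move=> Bp; split; first by case: Bp.
have [eu ev] := argwP Bp; have n0 := B0_norm2_gt0 Bp.
move: eu ev; set r := Num.sqrt _ => eu ev.
by rewrite /rot_re /= eu ev -!mulrA -mulrDr -!expr2 cos2Dsin2 mulr1 sqrtr_gt0.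
Qed.

Lemma theta_liftP phi q : chart phi q -> theta q = toS1 (theta_lift phi q).
Proof.
move=> Nq; have Bq := chart_B0 Nq; have [_ /= a0] := Nq.
have [eu ev] := argwP Bq; have n0 := B0_norm2_gt0 Bq.
set r := Num.sqrt _ in eu ev; have r0 : 0 < r by rewrite sqrtr_gt0.
have ea : rot_re phi q = r * cos (argw q - phi).
  by rewrite cosB /rot_re eu ev; ring.
have eb : rot_im phi q = r * sin (argw q - phi).
  by rewrite sinB /rot_im eu ev; ring.
rewrite /theta /theta_lift -!toS1D (atan_polar a0 r0 ea eb) !toS1D.
by congr toS1; ring.
Qed.

Lemma smooth_slope U : open U -> (forall q, U q -> 0 < cy q) ->
  smooth U (@slope R).
Proof.
move=> oU y0; rewrite /slope /cx /cy; smooth_rules => // q Uq.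
by rewrite gt_eqF // y0.
Qed.

Lemma smooth_logscale (U : set 'rV[R]_4) :
  open U -> (forall q, U q -> 0 < cy q) ->
  smooth U (@logscale R).
Proof.
move=> oU y0; apply: smoothM => //; last exact: smooth_cst.
apply: (smooth_comp oU y0); first exact: smooth_ln.
exact: smooth_coord.
Qed.

Lemma smooth_theta_lift phi : smooth (chart phi) (theta_lift phi).
Proof.
have oN := @open_chart phi.
have sl : smooth (chart phi) (fun q => slope q).
  by apply: smooth_slope => // q [].
have sa : smooth (chart phi) (fun q => rot_im phi q / rot_re phi q).
  rewrite /rot_im /rot_re /cu /cv; smooth_rules => // q [_] /= a0.
  by rewrite gt_eqF.
have sA : smooth (chart phi) (fun q => atan (rot_im phi q / rot_re phi q)).
  exact: (smooth_comp (phi := @atan R) oN _ (@smooth_atan R) sa).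
apply: smoothD => //; first by apply: smoothD => //; exact: smooth_cst.
by apply: smoothN => //; apply: smoothM => //; exact: smooth_cst.
Qed.

Definition angles p : R * circle R := (logscale p, theta p).

Lemma cov_RS1_surj (z : R * circle R) : exists c, cov_RS1 c = z.
Proof.
case: z => s th.
exists (row_of 2 [:: s; repr (th : Quotient.quot (@period R))]).
by rewrite /cov_RS1 !row_of_entry /= /toS1 reprK.
Qed.

Lemma cov_S1R3_surj (z : circle R * R * R * R) : exists c, cov_S1R3 c = z.
Proof.
case: z => -[[th a] b] d.
exists (row_of 4 [:: (repr (th : Quotient.quot (@period R)) : R); a; b; d]).
by rewrite /cov_S1R3 !row_of_entry /= /toS1 reprK.
Qed.

(** Raising the argument by 3/2 k cancels the slope correction in theta. *)
Lemma theta_point k t s phi :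
  theta (point_of k t s (phi + 3 / 2 * k)) = toS1 phi.
Proof.
by rewrite /theta slope_point -toS1B argw_point toS1B addrK.
Qed.

Lemma smooth_map_angles : smooth_map (@cov_RS1 R) (@B0 R) angles.
Proof.
move=> p Bp; exists (chart (argw p)),
  (fun q => row_of 2 [:: logscale q; theta_lift (argw p) q]); split.
- exact: (@open_chart).
- exact: chart_argw.
- apply/smooth_smooth_on/smooth_row_of => [|[|[|i]]] //=.
    exact: (@open_chart).
    by move=> _; apply: smooth_logscale => [|q []] //; exact: (@open_chart).
  by move=> _; exact: smooth_theta_lift.
- by move=> q Bq Nq; rewrite /cov_RS1 !row_of_entry /= -(theta_liftP Nq).
Qed.

Definition d_arg p V := (cu p * cv V - cv p * cu V) / (cu p ^+ 2 + cv p ^+ 2).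
Definition d_slope p V := cx V / cy p - cx p * cy V / cy p ^+ 2.
Definition d_invt p V := 3 * cy p ^+ 2 * (cu p ^+ 2 + cv p ^+ 2) * cy V
   + 2 * cy p ^+ 3 * (cu p * cu V + cv p * cv V).
Definition d_logscale p V := cy V / (2 * cy p).

Lemma has_diff_slope p V : 0 < cy p -> has_diff (@slope R) p V (d_slope p V).
Proof.
move=> y0; have yn : cy p != 0 by rewrite gt_eqF.
rewrite /slope; apply: has_diff_eq.
  apply: has_diffM; first exact: has_diff_coord.
  by apply: has_diffV => //; exact: has_diff_coord.
rewrite /d_slope /cx /cy in yn *; by field.
Qed.

Lemma has_diff_theta_lift phi p V : chart phi p ->
  has_diff (theta_lift phi) p V (d_arg p V - 3 / 2 * d_slope p V).
Proof.
move=> Np; have [/= y0 a0] := Np; have an : rot_re phi p != 0 by rewrite gt_eqF.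
have n0 := B0_norm2_gt0 (chart_B0 Np).
have da : has_diff (rot_re phi) p V (rot_re phi V).
  apply: has_diff_eq; first by rewrite /rot_re /cu /cv; has_diff_rules.
  by rewrite /rot_re /cu /cv; ring.
have db : has_diff (rot_im phi) p V (rot_im phi V).
  apply: has_diff_eq; first by rewrite /rot_im /cu /cv; has_diff_rules.
  by rewrite /rot_im /cu /cv; ring.
apply: has_diff_eq.
  apply: has_diffD; last first.
    apply: has_diffN; apply: has_diffM; first exact: has_diff_cst.
    exact: has_diff_slope.
  apply: has_diffD; first exact: has_diff_cst.
  apply: (has_diff_comp (phi := @atan R)).
  by apply: has_diffM; [exact: db|apply: has_diffV => //; exact: da].
rewrite mulr0 addr0 add0r; congr (_ - _).
have e : cu p ^+ 2 + cv p ^+ 2 = rot_re phi p ^+ 2 + rot_im phi p ^+ 2.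
  rewrite /rot_re /rot_im -[LHS]mulr1 -(cos2Dsin2 phi); ring.
have e' : cu p * cv V - cv p * cu V =
    rot_re phi p * rot_im phi V - rot_im phi p * rot_re phi V.
  rewrite /rot_re /rot_im -[LHS]mulr1 -(cos2Dsin2 phi); ring.
rewrite e in n0; rewrite /d_arg e e'.
move: (rot_re phi p) (rot_im phi p) an n0 => a b an n0.
move: (rot_re phi V) (rot_im phi V) => a' b'.
have n1 : a ^+ 2 + b ^+ 2 != 0 by rewrite gt_eqF.
by field; rewrite an n1.
Qed.

(** Near p the circle-valued difference theta q - theta p is the class of the
difference L of two values of a real lift; L is small, hence equal to its
representative in [-pi, pi[. *)
Lemma dS1_theta p V : B0 p -> dS1 theta p V = d_arg p V - 3 / 2 * d_slope p V.
Proof.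
move=> Bp; set phi := argw p; have Np := chart_argw Bp.
have [dL DL] := has_diff_theta_lift V Np.
pose L q := theta_lift phi q - theta_lift phi p.
have near_L : {near p, (fun q => ang (theta q - theta p)) =1 L}.
  have N1 : nbhs p (chart phi) := open_nbhs_nbhs (conj (@open_chart phi) Np).
  have N2 : \forall q \near p, `|theta_lift phi p - theta_lift phi q| < pi.
    have := differentiable_continuous dL.
    by move/cvgrPdist_lt => /(_ pi (pi_gt0 R)).
  apply: filterS2 N1 N2 => q Nq Lq.
  rewrite /= (theta_liftP Nq) (theta_liftP Np) toS1B ang_toS1 //.
  move: Lq; rewrite ltr_norml => /andP[l1 l2].
  by apply/andP; split; rewrite -/phi; lra.
have [dLL DLL] : has_diff L p V (d_arg p V - 3 / 2 * d_slope p V).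
  rewrite -[X in has_diff _ _ _ X]addr0 /L.
  apply: has_diffD; first exact: has_diff_theta_lift.
  exact: has_diff_cst.
by rewrite /dS1 (diff_near_eq V near_L).
Qed.

Lemma has_diff_invt p V : has_diff (@invt R) p V (d_invt p V).
Proof.
apply: has_diff_eq.
  by rewrite /invt /cu /cv /cy; has_diff_rules.
by rewrite /d_invt /cu /cv /cy /=; ring.
Qed.

Lemma has_diff_logscale p V : 0 < cy p ->
  has_diff (@logscale R) p V (d_logscale p V).
Proof.
move=> y0; apply: has_diff_eq.
  rewrite /logscale; apply: has_diffM; last exact: has_diff_cst.
  apply: (has_diff_comp (phi := @ln R)); last exact: has_diff_coord.
  exact: is_derive1_ln.
by rewrite /d_logscale mulr0 add0r /cy in y0 *; field; rewrite gt_eqF.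
Qed.

Lemma smooth_invt U : open U -> smooth U (@invt R).
Proof.
move=> oU; rewrite /invt /cy /cu /cv.
have e : (fun p : 'rV[R]_4 => p 0 1 ^+ 3 * (p 0 2 ^+ 2 + p 0 3 ^+ 2)) =
  (fun p => (p 0 1 * p 0 1 * p 0 1) * (p 0 2 * p 0 2 + p 0 3 * p 0 3)).
  by apply/funext => p; ring.
by rewrite e; smooth_rules.
Qed.

Lemma smooth_point_of (V : normedModType R) (U : set V) (K T S P : V -> R) :
  open U -> (forall c, U c -> 0 < T c) ->
  smooth U K -> smooth U T -> smooth U S -> smooth U P ->
  smooth U (fun c => point_of (K c) (T c) (S c) (P c)).
Proof.
move=> oU T0 sK sT sS sP.
have s2 : smooth U (fun c => expR (2 * S c)).
  apply: (smooth_comp (I := setT)) => //; first exact: smooth_expR.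
  by smooth_rules.
have sr : smooth U (fun c => modulus (T c) (S c)).
  apply: (smooth_comp (I := setT)) => //; first exact: smooth_expR.
  smooth_rules => //.
  by apply: (smooth_comp oU T0 _ sT); exact: smooth_ln.
have [ss sc] := @smooth_sin_cos R.
have sin_ : smooth U (fun c => sin (P c)) by apply: (smooth_comp oU _ ss sP).
have cos_ : smooth U (fun c => cos (P c)) by apply: (smooth_comp oU _ sc sP).
apply: smooth_row => // -[[|[|[|[|i]]]] Hi] //=; smooth_rules => //.
Qed.

Definition rotation p : 'rV[R]_4 := row_of 4 [:: 0; 0; - cv p; cu p].
Definition dilation p : 'rV[R]_4 :=
  row_of 4 [:: 2 * cx p; 2 * cy p; - (3 * cu p); - (3 * cv p)].

Lemma row4E (a b c d : R) :
  (cx (row_of 4 [:: a; b; c; d]) = a) * (cy (row_of 4 [:: a; b; c; d]) = b) *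
  (cu (row_of 4 [:: a; b; c; d]) = c) * (cv (row_of 4 [:: a; b; c; d]) = d).
Proof. by rewrite /cx /cy /cu /cv !mxE. Qed.

Lemma derive_point_arg k t s phi :
  'D_1 (fun h : R => point_of k t s (phi + h)) 0 =
  rotation (point_of k t s phi).
Proof.
have dl : has_diff (fun h : R => phi + h) 0 1 (0 + 1).
  by apply: has_diffD; [exact: has_diff_cst|exact: has_diff_id].
apply: derive_row_of => -[|[|[|[|i]]]] //= _; rewrite ?pointE.
- exact: has_diff_cst.
- exact: has_diff_cst.
- apply: has_diff_eq.
    apply: has_diffM; first exact: has_diff_cst.
    exact: (has_diff_comp (phi := @cos R) _ dl).
  by rewrite /= addr0; ring.
- apply: has_diff_eq.
    apply: has_diffM; first exact: has_diff_cst.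
    exact: (has_diff_comp (phi := @sin R) _ dl).
  by rewrite /= addr0; ring.
Qed.

Lemma derive_point_logscale k t s phi :
  'D_1 (fun h : R => point_of k t (h + s) phi) 0 =
  dilation (point_of k t s phi).
Proof.
have dl : has_diff (fun h : R => h + s) 0 1 (1 + 0).
  by apply: has_diffD; [exact: has_diff_id|exact: has_diff_cst].
have d2 : has_diff (fun h : R => expR (2 * (h + s))) 0 1 (2 * expR (2 * s)).
  apply: has_diff_eq.
    apply: (has_diff_comp (phi := @expR R)).
    by apply: has_diffM; [exact: has_diff_cst|exact: dl].
  by rewrite /= add0r; ring.
have dr : has_diff (fun h : R => modulus t (h + s)) 0 1 (- (3 * modulus t s)).
  apply: has_diff_eq.
    apply: (has_diff_comp (phi := @expR R)).
    apply: has_diffD; first exact: has_diff_cst.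
    by apply: has_diffN; apply: has_diffM; [exact: has_diff_cst|exact: dl].
  by rewrite /= add0r -/(modulus t s); ring.
apply: derive_row_of => -[|[|[|[|i]]]] //= _; rewrite ?pointE.
- apply: has_diff_eq.
    by apply: has_diffM; [exact: has_diff_cst|exact: d2].
  by rewrite /=; ring.
- exact: d2.
- apply: has_diff_eq.
    by apply: has_diffM; [exact: dr|exact: has_diff_cst].
  by rewrite /=; ring.
- apply: has_diff_eq.
    by apply: has_diffM; [exact: dr|exact: has_diff_cst].
  by rewrite /=; ring.
Qed.

End Angle.

(** * The Darboux frame *)

Section Darboux.
Variables (R : realType) (f : R -> R).
Implicit Types (p q V W X : 'rV[R]_4) (k t s phi : R).

Definition d_theta p V := d_arg p V - 3 / 2 * d_slope p V.
Definition d_H1 p V := 2 / 3 * (half_derive f (invt p) * d_invt p V).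
Definition d_H2 p V :=
  2 * (1 - f (invt p)) * d_slope p V
  - 2 * slope p * (half_derive f (invt p) * d_invt p V).

Lemma eq_wedge (a a' b b' : 'rV[R]_4 -> R) V W :
  a =1 a' -> b =1 b' -> wedge a b V W = wedge a' b' V W.
Proof. by move=> ea eb; rewrite /wedge !ea !eb. Qed.

(** All four differentials are explicit linear forms in V, so this is an
identity of rational functions in which f and f' are free parameters. *)
Lemma omega_darboux p V W : B0 p ->
  omega f p V W = wedge (d_theta p) (d_H1 p) V W
                + wedge (d_logscale p) (d_H2 p) V W.
Proof.
move=> Bp; have [y0 _] := Bp; have n0 := B0_norm2_gt0 Bp.
rewrite /omega /d_theta /d_H1 /d_H2 /wedge.
rewrite /d_arg /d_slope /d_invt /d_logscale /slope /dx /dy /du /dv.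
move: (f _) (half_derive _ _) => F F'.
move: (cx p) (cy p) (cu p) (cv p) y0 n0 => x y u v y0 n0.
move: (cx V) (cy V) (cu V) (cv V) => xV yV uV vV.
move: (cx W) (cy W) (cu W) (cv W) => xW yW uW vW.
by field; rewrite !gt_eqF.
Qed.

(** The rotation of w preserves t, x/y and y; it only moves theta. *)
Lemma darboux_rotation p : B0 p ->
  [/\ d_theta p (rotation p) = 1, d_H1 p (rotation p) = 0,
      d_logscale p (rotation p) = 0 & d_H2 p (rotation p) = 0].
Proof.
move=> Bp; have n0 := B0_norm2_gt0 Bp; have nn := lt0r_neq0 n0.
have tE : d_invt p (rotation p) = 0 by rewrite /d_invt /rotation !row4E; ring.
have kE : d_slope p (rotation p) = 0 by rewrite /d_slope /rotation !row4E; ring.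
rewrite /d_H1 /d_H2 /d_theta tE kE; split; try by ring.
  by rewrite /d_arg /rotation !row4E; field.
by rewrite /d_logscale /rotation !row4E; ring.
Qed.

(** The flow (e^{2h} x, e^{2h} y, e^{-3h} w) preserves t = y^3 |w|^2, x/y and
arg w. *)
Lemma darboux_dilation p : B0 p ->
  [/\ d_theta p (dilation p) = 0, d_H1 p (dilation p) = 0,
      d_logscale p (dilation p) = 1 & d_H2 p (dilation p) = 0].
Proof.
move=> Bp; have [y0 _] := Bp; have n0 := B0_norm2_gt0 Bp.
have nn := lt0r_neq0 n0; have yn := lt0r_neq0 y0.
have tE : d_invt p (dilation p) = 0 by rewrite /d_invt /dilation !row4E; ring.
have kE : d_slope p (dilation p) = 0.
  by rewrite /d_slope /dilation !row4E; field.
rewrite /d_H1 /d_H2 /d_theta tE kE; split; try by ring.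
  by rewrite /d_arg /dilation !row4E; field.
by rewrite /d_logscale /dilation !row4E; field.
Qed.

Hypothesis f_le0 : forall t, 0 <= t -> f t <= 0.
Hypothesis f_smooth : half_smooth f.
Hypothesis f'_lt0 : forall t, 0 <= t -> half_derive f t < 0.

(** Pairing with the rotation and the dilation fields recovers dH1 and dH2 of
a vector, hence its dt and its d(x/y), since f' < 0 < 1 - f. Pairing with
d/dx, on which dH1 and ds vanish, recovers ds, hence dy and dx. Pairing with
the radial field in w, on which dH1 does not vanish, recovers dtheta. The
angular and radial components of dw determine the vector. *)
Lemma omega_nondegenerate p X Y : B0 p ->
  (forall V, omega f p X V = omega f p Y V) -> X = Y.
Proof.
move=> Bp XY; have [y0 _] := Bp.
have n0 := B0_norm2_gt0 Bp; have t0 := invt_gt0 Bp.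
have F'0 := f'_lt0 (ltW t0); have F0 := f_le0 (ltW t0).
have nn := lt0r_neq0 n0; have yn := lt0r_neq0 y0.
have E V : wedge (d_theta p) (d_H1 p) X V
                + wedge (d_logscale p) (d_H2 p) X V =
   wedge (d_theta p) (d_H1 p) Y V
                + wedge (d_logscale p) (d_H2 p) Y V by rewrite -!omega_darboux.
have e1 : d_H1 p X = d_H1 p Y.
  have := E (rotation p); have [r1 r2 r3 r4] := darboux_rotation Bp.
  by rewrite /wedge r1 r2 r3 r4; lra.
have e2 : d_H2 p X = d_H2 p Y.
  have := E (dilation p); have [r1 r2 r3 r4] := darboux_dilation Bp.
  by rewrite /wedge r1 r2 r3 r4; lra.
have tt : (2 / 3 : R) != 0 by rewrite gt_eqF //; lra.
have F'n : half_derive f (invt p) != 0 by rewrite lt_eqF.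
have et : d_invt p X = d_invt p Y by move: e1 => /(mulfI tt) /(mulfI F'n).
have Fn : 2 * (1 - f (invt p)) != 0 by rewrite gt_eqF //; lra.
have ek : d_slope p X = d_slope p Y.
  by move: e2; rewrite /d_H2 et => /addIr /(mulfI Fn).
have ey : cy X = cy Y.
  have := E (row_of 4 [:: 1; 0; 0; 0]); rewrite /wedge e1 e2.
  have -> : d_H1 p (row_of 4 [:: 1; 0; 0; 0]) = 0.
    by rewrite /d_H1 /d_invt !row4E; ring.
  have -> : d_logscale p (row_of 4 [:: 1; 0; 0; 0]) = 0.
    by rewrite /d_logscale !row4E mul0r.
  have -> : d_H2 p (row_of 4 [:: 1; 0; 0; 0]) =
      2 * (1 - f (invt p)) / cy p.
    by rewrite /d_H2 /d_invt /d_slope !row4E; field.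
  rewrite !mulr0 !mul0r !subr0 !add0r => /addrI /mulIf.
  rewrite mulf_neq0 ?invr_eq0 //.
  by move=> /(_ isT) /mulIf; apply; rewrite invr_eq0 mulf_neq0.
have ex : cx X = cx Y.
  by move: ek; rewrite /d_slope ey => /addIr /mulIf; apply; rewrite invr_eq0.
have eth : d_theta p X = d_theta p Y.
  have := E (row_of 4 [:: 0; 0; cu p; cv p]); rewrite /wedge e1 e2.
  have -> : d_logscale p (row_of 4 [:: 0; 0; cu p; cv p]) = 0.
    by rewrite /d_logscale !row4E mul0r.
  have -> : d_H1 p (row_of 4 [:: 0; 0; cu p; cv p]) =
      2 / 3 * (half_derive f (invt p)
               * (2 * cy p ^+ 3 * (cu p ^+ 2 + cv p ^+ 2))).
    by rewrite /d_H1 /d_invt !row4E; ring.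
  rewrite /d_logscale ey => /addIr /addIr /mulIf; apply.
  by rewrite !mulf_neq0 // expf_neq0.
have ea : cu p * cv X - cv p * cu X = cu p * cv Y - cv p * cu Y.
  move: eth; rewrite /d_theta ek => /addIr /mulIf; apply.
  by rewrite invr_eq0.
have er : cu p * cu X + cv p * cv X = cu p * cu Y + cv p * cv Y.
  move: et; rewrite /d_invt ey => /addrI /mulfI; apply.
  by rewrite mulf_neq0 // expf_neq0.
apply: eq_of_coords => //; apply: (mulfI nn).
- have -> : (cu p ^+ 2 + cv p ^+ 2) * cu X = cu p * (cu p * cu X + cv p * cv X)
    - cv p * (cu p * cv X - cv p * cu X) by ring.
  by rewrite er ea; ring.
- have -> : (cu p ^+ 2 + cv p ^+ 2) * cv X = cv p * (cu p * cu X + cv p * cv X)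
    + cu p * (cu p * cv X - cv p * cu X) by ring.
  by rewrite er ea; ring.
Qed.

Let sf := half_smooth_pos f_smooth.
Let f'E t : 0 < t -> 'D_1 f t = half_derive f t.
Proof. by move=> t0; rewrite half_deriveE. Qed.
Let f'pos_lt0 t : 0 < t -> 'D_1 f t < 0.
Proof. by move=> t0; rewrite f'E // f'_lt0 // ltW. Qed.

Lemma has_diff_f_invt p V : B0 p ->
  has_diff (fun q => f (invt q)) p V (half_derive f (invt p) * d_invt p V).
Proof.
move=> Bp; have t0 := invt_gt0 Bp; apply: has_diff_comp (has_diff_invt p V).
by rewrite -f'E //; apply: derivableP; exact: derivable_pos.
Qed.

Lemma has_diff_H1 p V : B0 p -> has_diff (H1 f) p V (d_H1 p V).
Proof.
move=> Bp; apply: has_diff_eq.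
  by apply: has_diffM; [exact: has_diff_cst|exact: has_diff_f_invt].
by rewrite mulr0 addr0.
Qed.

Lemma has_diff_H2 p V : B0 p -> has_diff (H2 f) p V (d_H2 p V).
Proof.
move=> Bp; have [y0 _] := Bp; apply: has_diff_eq.
  apply: has_diffM; first apply: has_diffM; first exact: has_diff_cst.
    exact: (has_diff_slope V y0).
  apply: has_diffD; first exact: has_diff_cst.
  by apply: has_diffN; exact: has_diff_f_invt.
by rewrite /d_H2 /slope; ring.
Qed.

(** Nondegeneracy makes the choice in the definition of the Hamiltonian field
irrelevant. *)
Lemma hamiltonian_vfE p X g d : B0 p ->
  (forall V, has_diff g p V (d V)) -> (forall V, omega f p X V = d V) ->
  hamiltonian_vf f g p = X.
Proof.
move=> Bp dg XE; apply: (@omega_nondegenerate p) => // V.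
rewrite XE -(diff_has_diff (dg V)).
pose dual := [set Y | forall V, omega f p Y V = 'd g p V].
suff : dual (hamiltonian_vf f g p) by exact.
apply: (@getPex _ dual).
by exists X => W; rewrite XE -(diff_has_diff (dg W)).
Qed.

Lemma hamiltonian_H1 p : B0 p -> hamiltonian_vf f (H1 f) p = rotation p.
Proof.
move=> Bp; apply: (hamiltonian_vfE Bp) => V; first exact: has_diff_H1.
have [r1 r2 r3 r4] := darboux_rotation Bp.
by rewrite omega_darboux // /wedge r1 r2 r3 r4; ring.
Qed.

Lemma hamiltonian_H2 p : B0 p -> hamiltonian_vf f (H2 f) p = dilation p.
Proof.
move=> Bp; apply: (hamiltonian_vfE Bp) => V; first exact: has_diff_H2.
have [r1 r2 r3 r4] := darboux_dilation Bp.
by rewrite omega_darboux // /wedge r1 r2 r3 r4; ring.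
Qed.

Definition fibre_param k t (c : 'rV[R]_2) : 'rV[R]_4 :=
  point_of k t (c 0 0) (c 0 1 + 3 / 2 * k).

(** The inverse of the frame: H1 gives f t, then t; H2 = 2 (x/y) (1 - f t)
gives the slope. *)
Definition inv_frame (c : 'rV[R]_4) : 'rV[R]_4 :=
  let k := c 0 3 / (2 * (1 - 3 / 2 * c 0 1)) in
  point_of k (inv_pos f (3 / 2 * c 0 1)) (c 0 2) (c 0 0 + 3 / 2 * k).

Lemma one_sub_f_neq0 p : B0 p -> 1 - f (invt p) != 0.
Proof. by move=> /invt_gt0/ltW/f_le0 F0; rewrite gt_eqF //; lra. Qed.

Lemma H2E p : H2 f p = 2 * slope p * (1 - f (invt p)).
Proof. by []. Qed.

(** f is injective on the positive half-line and 1 - f does not vanish. *)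
Lemma fibre_invariants p q : B0 p -> B0 q -> H f p = H f q ->
  invt p = invt q /\ slope p = slope q.
Proof.
move=> Bp Bq [h1 h2]; have tt : (2 / 3 : R) != 0 by rewrite gt_eqF //; lra.
have fE : f (invt p) = f (invt q) by exact: mulfI tt _ _ h1.
have tE : invt p = invt q.
  by apply: (inj_pos sf f'pos_lt0) => //; exact: invt_gt0.
split=> //; move: h2; rewrite !H2E tE.
by move=> /(mulIf (one_sub_f_neq0 Bq)) /mulfI; apply; rewrite pnatr_eq0.
Qed.

Lemma diffeo_fibre b : B f b ->
  diffeo (@cov_RS1 R) (fibre f b) [set: R * circle R] (@angles R).
Proof.
move=> [p0 Bp0 Hp0]; have t0 := invt_gt0 Bp0.
have [] // := @diffeo_of_inverse _ _ _ _ (@cov_RS1 R) (fibre f b) setT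
  (@angles R) (fibre_param (slope p0) (invt p0)).
- exact: cov_RS1_surj.
- exact: openT.
- by apply: smooth_mapW (@smooth_map_angles R) => q [].
- move=> c _; split; last first.
    by rewrite /angles /fibre_param logscale_point theta_point.
  split; first exact: point_B0.
  by rewrite /= -Hp0 /H /H1 !H2E /fibre_param invt_point // slope_point.
- move=> p c [Bp /= Hp]; rewrite /cov_RS1 /angles => -[cs ct].
  have [te se] := fibre_invariants Bp Bp0 (etrans Hp (esym Hp0)).
  rewrite /fibre_param -te -se cs -[RHS](point_coords Bp); apply: point_of_toS1.
  by rewrite -toS1D ct /theta toS1D subrK.
- rewrite preimage_setT; apply: smooth_point_of => //.
  + exact: openT.
  + exact: smooth_cst.
  + exact: smooth_cst.
  + exact: smooth_coord.
  + by apply: smoothD; [exact: openT|exact: smooth_coord|exact: smooth_cst].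
Qed.

(** H1 is the only constrained coordinate: it ranges over 2/3 of the image of
f on the positive half-line. *)
Lemma frame_imageE :
  @cov_S1R3 R @^-1` (frame f (@angles R) @` @B0 R) =
  [set c | image_pos f (3 / 2 * c 0 1)].
Proof.
apply/seteqP; split=> c /=.
  move=> [p Bp]; rewrite /frame /cov_S1R3 => -[_ <- _ _].
  exists (invt p); first exact: invt_gt0.
  by rewrite /H1; field.
move=> [t /= t0 tE]; have ft : f t <= 0 by apply: f_le0; exact: ltW.
pose k := c 0 3 / (2 * (1 - f t)).
exists (point_of k t (c 0 2) (c 0 0 + 3 / 2 * k)); first exact: point_B0.
rewrite /frame /angles /= logscale_point theta_point H2E /H1.
rewrite invt_point // slope_point.
rewrite /cov_S1R3; congr (_, _, _, _); first by rewrite tE; field.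
by rewrite /k; field; rewrite gt_eqF //; lra.
Qed.

Lemma inv_frameP (c : 'rV[R]_4) : image_pos f (3 / 2 * c 0 1) ->
  B0 (inv_frame c) /\ frame f (@angles R) (inv_frame c) = cov_S1R3 c.
Proof.
move=> /inv_posP [t0 tE]; split; first exact: point_B0.
rewrite /frame /angles /= logscale_point theta_point H2E /H1.
rewrite invt_point // slope_point.
have ft : 3 / 2 * c 0 1 <= 0 by rewrite -tE; apply: f_le0; exact: ltW.
rewrite /cov_S1R3 tE; congr (_, _, _, _); first by field.
by field; rewrite gt_eqF //; lra.
Qed.

Lemma inv_frameK p (c : 'rV[R]_4) :
  B0 p -> cov_S1R3 c = frame f (@angles R) p -> inv_frame c = p.
Proof.
move=> Bp; rewrite /frame /cov_S1R3 /angles /= => -[ct c1 cs c3].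
have t0 := invt_gt0 Bp.
have e1 : 3 / 2 * c 0 1 = f (invt p) by rewrite c1 /H1; field.
have ek : c 0 3 / (2 * (1 - 3 / 2 * c 0 1)) = slope p.
  by rewrite e1 c3 H2E; field; exact: one_sub_f_neq0.
rewrite /inv_frame ek e1 cs (inv_posK sf f'pos_lt0) // -[RHS](point_coords Bp).
by apply: point_of_toS1; rewrite -toS1D ct /theta toS1D subrK.
Qed.

Lemma open_frame_image : open [set c : 'rV[R]_4 | image_pos f (3 / 2 * c 0 1)].
Proof.
apply: (@open_comp _ _ (fun c : 'rV[R]_4 => 3 / 2 * c 0 1) (image_pos f));
  last exact: (@open_image_pos _ _ sf f'pos_lt0).
move=> c _; apply: differentiable_continuous.
have s : smooth setT (fun c : 'rV[R]_4 => 3 / 2 * c 0 1 : R).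
  by apply: smoothM; [exact: openT|exact: smooth_cst|exact: smooth_coord].
exact: smooth_upto_differentiable (s 0%N) _.
Qed.

Lemma smooth_inv_frame :
  smooth [set c : 'rV[R]_4 | image_pos f (3 / 2 * c 0 1)] inv_frame.
Proof.
set U := (X in smooth X _); have oU : open U := @open_frame_image.
have s1 : smooth U (fun c : 'rV[R]_4 => 3 / 2 * c 0 1 : R).
  by apply: smoothM => //; [exact: smooth_cst|exact: smooth_coord].
have st : smooth U (fun c => inv_pos f (3 / 2 * c 0 1)).
  apply: (smooth_comp (I := image_pos f) oU _ _ s1) => //.
  exact: smooth_inv_pos sf f'pos_lt0.
have sk : smooth U (fun c : 'rV[R]_4 => c 0 3 / (2 * (1 - 3 / 2 * c 0 1))).
  apply: smoothM => //; first exact: smooth_coord.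
  apply: smoothV => //.
    move=> c [t t0 tE]; have := f_le0 (ltW t0); rewrite tE => h.
    by rewrite gt_eqF //; lra.
  apply: smoothM => //; first exact: smooth_cst.
  by apply: smoothD => //; [exact: smooth_cst|exact: smoothN].
apply: smooth_point_of => //.
- by move=> c /inv_posP[].
- exact: smooth_coord.
- apply: smoothD => //; first exact: smooth_coord.
  by apply: smoothM => //; exact: smooth_cst.
Qed.

(** The second part replaces the abstract inverse by the formula inv_frame,
from which the coordinate fields are computed. *)
Lemma diffeo_frame :
  diffeo (@cov_S1R3 R) (@B0 R) (frame f (@angles R) @` @B0 R)
    (frame f (@angles R)) /\
  {in (@cov_S1R3 R @^-1` (frame f (@angles R) @` @B0 R)),
     inv_on (@B0 R) (frame f (@angles R)) \o @cov_S1R3 R =1 inv_frame}.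
Proof.
apply: diffeo_of_inverse.
- exact: cov_S1R3_surj.
- rewrite frame_imageE; exact: (@open_frame_image).
- move=> p Bp; exists (chart (argw p)),
    (fun q => row_of 4 [:: theta_lift (argw p) q; H1 f q; logscale q; H2 f q]).
  have oN := @open_chart R (argw p).
  have sft : smooth (chart (argw p)) (fun q => f (invt q)).
    apply: (smooth_comp (I := [set x : R | 0 < x]) oN) => //;
      last exact: smooth_invt.
    by move=> q /chart_B0/invt_gt0.
  split => //.
  + exact: chart_argw.
  + apply/smooth_smooth_on/smooth_row_of => // -[|[|[|[|i]]]] //= _.
    * exact: smooth_theta_lift.
    * by apply: smoothM => //; exact: smooth_cst.
    * by apply: smooth_logscale => // q [].
    * apply: smoothM => //.
        apply: smoothM => //; first exact: smooth_cst.
        by apply: smooth_slope => // q [].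
      by apply: smoothD => //; [exact: smooth_cst|exact: smoothN].
  + move=> q Bq Nq.
    by rewrite /cov_S1R3 /frame !row_of_entry /= -(theta_liftP Nq).
- by [].
- move=> c Oc; apply: inv_frameP.
  have : (@cov_S1R3 R @^-1` (frame f (@angles R) @` @B0 R)) c by [].
  by rewrite frame_imageE.
- exact: inv_frameK.
- rewrite frame_imageE; exact: smooth_inv_frame.
Qed.

Lemma derive_inv_frame p c (i : 'I_4) :
  B0 p -> cov_S1R3 c = frame f (@angles R) p ->
  coord_vf (frame f (@angles R)) i c =
  'D_1 (fun h : R => inv_frame (h *: delta_mx 0 i + c)) 0.
Proof.
move=> Bp cE; rewrite /coord_vf -derive_line; apply: near_eq_derive.
have oO : open (@cov_S1R3 R @^-1` (frame f (@angles R) @` @B0 R)).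
  rewrite frame_imageE; exact: (@open_frame_image).
apply: (open_eq_near oO diffeo_frame.2) => /=.
by exists p.
Qed.

Lemma coord_vf_theta p c : B0 p -> cov_S1R3 c = frame f (@angles R) p ->
  coord_vf (frame f (@angles R)) 0 c = rotation p.
Proof.
move=> Bp cE; rewrite (derive_inv_frame _ Bp cE) -(inv_frameK Bp cE).
rewrite -derive_point_arg.
apply: eq_derive => h; rewrite /inv_frame !mxE /=.
by rewrite !mulr0 !add0r mulr1; congr point_of; ring.
Qed.

Lemma coord_vf_s p c : B0 p -> cov_S1R3 c = frame f (@angles R) p ->
  coord_vf (frame f (@angles R)) 2 c = dilation p.
Proof.
move=> Bp cE; rewrite (derive_inv_frame _ Bp cE) -(inv_frameK Bp cE).
rewrite -derive_point_logscale.
apply: eq_derive => h; rewrite /inv_frame !mxE /=.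
by rewrite !mulr0 !add0r mulr1.
Qed.

End Darboux.

Theorem theoremA (R : realType) (f : R -> R)
    (f_le0 : forall t : R, 0 <= t -> f t <= 0)
    (f_smooth : half_smooth f)
    (f0 : f 0 = 0)
    (f'_lt0 : forall t : R, 0 <= t -> half_derive f t < 0)
    (f_lim : f t @[t --> +oo] --> -oo) :
  exists stheta : 'rV[R]_4 -> R * circle R,
    let s := fun p => (stheta p).1 in
    let theta := fun p => (stheta p).2 in
    let Phi := frame f stheta in
    [/\ smooth_map (@cov_RS1 R) (@B0 R) stheta,
        forall b : R * R, B f b ->
          diffeo (@cov_RS1 R) (fibre f b) [set: R * circle R] stheta,
        diffeo (@cov_S1R3 R) (@B0 R) (Phi @` @B0 R) Phi,
        forall p c : 'rV[R]_4, B0 p -> cov_S1R3 c = Phi p ->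
          coord_vf Phi 0 c = hamiltonian_vf f (H1 f) p /\
          coord_vf Phi 2 c = hamiltonian_vf f (H2 f) p &
        forall p V W : 'rV[R]_4, B0 p ->
          omega f p V W =
            wedge (dS1 theta p) ('d (H1 f) p) V W
            + wedge ('d s p) ('d (H2 f) p) V W].
Proof.
exists (@angles R); split.
- exact: smooth_map_angles.
- by move=> b; exact: diffeo_fibre.
- by have [] := diffeo_frame f_le0 f_smooth f'_lt0.
- move=> p c Bp cE; split.
    rewrite (coord_vf_theta f_le0 f_smooth f'_lt0 Bp cE).
    by rewrite (hamiltonian_H1 f_le0 f_smooth f'_lt0 Bp).
  rewrite (coord_vf_s f_le0 f_smooth f'_lt0 Bp cE).
  by rewrite (hamiltonian_H2 f_le0 f_smooth f'_lt0 Bp).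
- move=> p V W Bp; have [y0 _] := Bp.
  rewrite omega_darboux //; congr (_ + _); apply: eq_wedge => X; apply: esym.
  + exact: dS1_theta.
  + exact: diff_has_diff (has_diff_H1 f_smooth X Bp).
  + exact: diff_has_diff (has_diff_logscale X y0).
  + exact: diff_has_diff (has_diff_H2 f_smooth X Bp).
Qed.
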